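(* For $d\in\mathbb{N}_{\geq 0}$ let $\mathcal{B}_d$ denote the complete binary tree of depth $d$. Then $\text{ffn}(\mathcal{B}_0)=1$, $\text{ffn}(\mathcal{B}_1)=\text{ffn}(\mathcal{B}_2)=2$, $\text{ffn}(\mathcal{B}_3)=\text{ffn}(\mathcal{B}_4)=3$ and $\text{ffn}(\mathcal{B}_5),\text{ffn}(\mathcal{B}_6)\in\{3,4\}$. Moreover, for all $d\in\mathbb{N}_{\geq 7}$, \[ \left\lfloor \frac{d-1}{2}\right\rfloor - \frac12 \log\left(\left\lfloor \frac{d-5}{2}\right\rfloor\right) - 2 < \text{ffn}(\mathcal{B}_d) \leq \left\lceil \frac{d}{2}\right\rceil + 1 . \]
   Context: All graphs are finite, simple and undirected. For a graph $G=(V,E)$ and $W\subseteq V$, $N(W)$ is the set of nodes in $V\setminus W$ adjacent to at least one node of $W$. For $m\in\mathbb{N}_{>0}$, an $m$-strategy of length $T$ is a sequence $(F_1,\dots,F_T)$ of subsets of $V$ with $|F_i|\le m$. Its burning sets are $B_0=V$ and $B_t=(B_{t-1}\setminus F_t)\cup N(B_{t-1}\setminus F_t)$ for $t\ge1$, where $F_t=\emptyset$ for $t>T$. The strategy is winning if $B_T=\emptyset$. The firefighter number $\text{ffn}(G)$ is the smallest $m$ for which a winning $m$-strategy for $G$ exists. A complete binary tree of depth $d$ is a rooted tree in which every leaf has distance exactly $d$ from the root and every non-leaf node has exactly two children ($\mathcal{B}_0$ is a single node). $\log$ denotes the logarithm to base $2$. *)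

(* Defs.v *)
From HB Require Import structures.
From mathcomp Require Import all_boot all_order all_algebra.
From mathcomp Require Import boolp reals exp.

Set Implicit Arguments.
Unset Strict Implicit.
Unset Printing Implicit Defensive.

Record sgraph := SGraph {
  vertex :> finType;
  adj : rel vertex;
  adj_sym : symmetric adj;
  adj_irrefl : irreflexive adj }.

Section Firefighting.
Variable G : sgraph.

Definition nbhd (W : {set G}) : {set G} :=
  [set v in ~: W | [exists w in W, adj w v]].

(* A strategy is the list [:: F_1; ...; F_T], so that F_t is the entry of index
   t - 1 and F_t = set0 for t > T. *)
Definition is_strategy (m : nat) (F : seq {set G}) : Prop :=
  forall A : {set G}, A \in F -> #|A| <= m.

Fixpoint burning (F : seq {set G}) (t : nat) : {set G} :=
  if t is t'.+1 then
    let W := burning F t' :\: nth set0 F t' in W :|: nbhd W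
  else [set: G].

Definition winning (F : seq {set G}) : Prop := burning F (size F) = set0.

Definition ff_wins (m : nat) : Prop :=
  0 < m /\ exists F : seq {set G}, is_strategy m F /\ winning F.

Lemma ff_wins_exists : exists m, `[< ff_wins m >].
Proof.
exists #|G|.+1; apply/asboolP; split=> //; exists [:: [set: G]]; split.
  by move=> A _; apply: leq_trans (max_card _) (leqnSn _).
rewrite /winning /= setDv set0U; apply/setP => v; rewrite !inE.
by apply/existsP => -[w]; rewrite inE.
Qed.

Definition ffn : nat := ex_minn ff_wins_exists.

End Firefighting.

Section Trees.
Variable G : sgraph.

Definition is_tree : Prop :=
  (forall x y : G, connect (@adj G) x y) /\
  (forall c : seq G, ucycle (@adj G) c -> size c <= 2).

(* Length of a shortest walk from x to y; a shortest walk has fewer than #|G|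
   edges, and the value is #|G| if there is no walk at all. *)
Definition dist (x y : G) : nat :=
  find (fun n => [exists p : n.-tuple G, path (@adj G) x p && (last x p == y)])
       (iota 0 #|G|).

Definition children (r x : G) : {set G} :=
  [set y | adj x y & dist r y == (dist r x).+1].

Definition is_leaf (r x : G) : bool := children r x == set0.

Definition complete_binary_tree (d : nat) : Prop :=
  is_tree /\
  exists r : G,
    (forall x : G, is_leaf r x -> dist r x = d) /\
    (forall x : G, ~~ is_leaf r x -> #|children r x| = 2).

End Trees.

(* Complete binary trees of every depth exist: take the binary words of length
   at most d, a word being adjacent to its tail. *)
Section Existence.
Variable d : nat.

Let word := d.-bseq bool.

Definition word_child (u v : word) : bool :=
  if (v : seq bool) is b :: v' then v' == u :> seq bool else false.

Definition word_adj : rel word := fun u v => word_child u v || word_child v u.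

Lemma word_childP (u v : word) :
  reflect (exists b, v = b :: u :> seq bool) (word_child u v).
Proof.
rewrite /word_child; case: (v : seq bool) => [|b v']; first by right; case.
by apply: (iffP eqP) => [->|[c [_ ->]]] //; exists b.
Qed.

Lemma word_adj_sym : symmetric word_adj.
Proof. by move=> u v; rewrite /word_adj orbC. Qed.

Lemma word_adj_irrefl : irreflexive word_adj.
Proof.
move=> u; rewrite /word_adj orbb; apply/word_childP => -[b /(congr1 size) /=].
by move/eqP; rewrite eqn_leq ltnn andbF.
Qed.

Definition word_tree : sgraph := SGraph word_adj_sym word_adj_irrefl.

Let eps : word_tree := [bseq].

Lemma word_adj_size (u v : word) : word_adj u v -> size v <= (size u).+1.
Proof. by case/orP=> /word_childP [b ->] //=; do 2!apply: leqW. Qed.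

Lemma word_path_size (u : word) (p : seq word) :
  path word_adj u p -> size (last u p) <= size u + size p.
Proof.
elim: p u => [|v p IHp] u /=; first by rewrite addn0.
case/andP=> /word_adj_size uv /IHp /leq_trans-> //.
by rewrite addnS -addSn leq_add2r.
Qed.

Lemma word_path_eps (w : word) :
  exists p : seq word,
    [/\ path word_adj eps p, last eps p = w & size p = size w].
Proof.
case: w => s; elim: s => [|b s IHs] /= le_s.
  by exists [::]; split=> //; apply: val_inj.
have [p [pp lp sp]] := IHs (ltnW le_s).
exists (rcons p (Bseq (le_s : size (b :: s) <= d))).
rewrite rcons_path pp lp last_rcons size_rcons sp; split=> //=.
by apply/orP; left; apply/word_childP; exists b.
Qed.

Lemma word_dist (w : word_tree) : dist eps w = size w.
Proof.
have [p [pp lp sp]] := word_path_eps w.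
have lt_w : size w < #|word_tree|.
  rewrite -lp; case/shortenP: pp => p' pp' up' _.
  have := word_path_size pp'; rewrite add0n => /leq_ltn_trans; apply.
  by rewrite -[X in X <= _]/(size (eps :: p')) -(card_uniqP up') max_card.
rewrite /dist; set a := (fun n => _).
have aw : a (size w).
  apply/existsP; exists (tcast sp (in_tuple p)).
  by rewrite val_tcast /= pp lp eqxx.
have hasa : has a (iota 0 #|word_tree|).
  by apply/hasP; exists (size w) => //; rewrite mem_iota.
apply/eqP; rewrite eqn_leq; apply/andP; split.
  rewrite leqNgt; apply/negP => /(before_find 0).
  by rewrite nth_iota // add0n aw.
have := nth_find 0 hasa; have := hasa; rewrite has_find size_iota => lt_f.
rewrite nth_iota // add0n => /existsP [q /andP[qp /eqP lq]].
by have := word_path_size qp; rewrite lq add0n size_tuple.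
Qed.

Lemma word_children (x : word_tree) : children eps x = [set y | word_child x y].
Proof.
apply/setP => y; rewrite !inE !word_dist.
apply/andP/idP => [[/orP[]// /word_childP[b ->] /=]|xy].
  by rewrite (ltn_eqF (leqnSn _)).
by split; [rewrite /= /word_adj xy | have /word_childP[b ->] := xy].
Qed.

Lemma word_tree_is_tree : is_tree word_tree.
Proof.
split=> [x y|c].
  have conn z : connect word_adj eps z.
    by have [p [pp <- _]] := word_path_eps z; apply/connectP; exists p.
  apply: (connect_trans (y := eps)); last exact: conn.
  by rewrite (sym_connect_sym word_adj_sym) conn.
have [//|] := leqP (size c) 2; case: c => // x0 c0; set c := x0 :: c0 => c_gt2 uc.
have x0c : x0 \in c by rewrite mem_head.
case: (arg_maxnP (fun z : word => size z) x0c) => x xc maxx.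
have [i c' rc] := rot_to xc.
have: ucycle word_adj (x :: c') by rewrite -rc /ucycle rot_cycle rot_uniq.
have: 2 < size (x :: c') by rewrite -rc size_rot.
have {maxx} maxx z : z \in x :: c' -> size z <= size x.
  by rewrite -rc mem_rot => /maxx.
have parent z : z \in x :: c' -> word_adj x z -> val z = behead (val x).
  move=> /maxx le_zx /orP[] /word_childP [b] Dz; last by rewrite /= Dz.
  by move: le_zx; rewrite Dz /= ltnn.
case: c' {rc} maxx parent => [|y c'] //; case/lastP: c' => [|c' z] // _ parent _.
case/andP => /= /andP[xy]; rewrite rcons_path last_rcons => /andP[_ zx].
case/andP=> _ /andP[+ _]; rewrite mem_rcons inE negb_or => /andP[/eqP[]].
apply: val_inj; rewrite (parent y) ?(parent z) ?inE ?eqxx ?orbT //.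
  by rewrite mem_rcons mem_head !orbT.
by rewrite word_adj_sym.
Qed.

Lemma complete_binary_tree_exists : complete_binary_tree word_tree d.
Proof.
split; first exact: word_tree_is_tree.
have childrenE (x : word_tree) (lt_x : size x < d) :
    children eps x = [set (Bseq (lt_x : size (true :: x) <= d) : word_tree);
                          (Bseq (lt_x : size (false :: x) <= d) : word_tree)].
  rewrite word_children; apply/setP => y; rewrite !inE.
  apply/word_childP/orP => [[[] Dy]|[]/eqP->]; last 2 first.
  - by exists true.
  - by exists false.
  - by left; apply/eqP/val_inj.
  - by right; apply/eqP/val_inj.
exists eps; split=> x.
  rewrite word_dist /is_leaf; have := size_bseq x.
  rewrite leq_eqVlt => /orP[/eqP //|lt_x]; rewrite (childrenE x lt_x).
  by move/eqP/setP/(_ (Bseq (lt_x : size (true :: x) <= d))); rewrite !inE eqxx.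
case/set0Pn=> y; rewrite {1}word_children inE => /word_childP[b Dy].
have lt_x : size x < d by have := size_bseq y; rewrite Dy.
by rewrite (childrenE x lt_x) cards2.
Qed.

End Existence.

Definition log2 (R : realType) (x : R) : R := (ln x / ln 2)%R.

(* Main.v *)
From mathcomp Require Import all_boot all_order all_algebra.
From mathcomp Require Import boolp reals exp.
From mathcomp Require Import zify lra.
Require Import Defs.

(* Upper bound: sweeping the tree along a path decomposition whose bags have
   uphalf d + 1 vertices extinguishes it.

   Lower bound: if every k-set D of vertices has at least m vertices with a
   neighbour outside D, then the extinguished set never has more than k - m
   vertices, so m firefighters lose. In the complete binary tree of depth d a
   set with b outer boundary vertices has size x + e + c 2^(d+1), where x is a
   sum of b signed powers of 2, c is 0 or 1 and -2b-1 <= e <= b. A number whose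
   leading binary digits alternate is not of this form when b is small: it
   takes as many signed powers of 2 as there are leading ones. *)

Set Implicit Arguments.
Unset Strict Implicit.
Unset Printing Implicit Defensive.

Import Order.TTheory GRing.Theory Num.Theory.

(** * The game in terms of extinguished sets *)

Section Game.
Variable G : sgraph.
Implicit Types (C D F : {set G}) (Fs : seq {set G}).

Definition interior D : {set G} :=
  [set x in D | [forall y, adj x y ==> (y \in D)]].

Lemma interiorP D x :
  reflect (x \in D /\ forall y, adj x y -> y \in D) (x \in interior D).
Proof.
rewrite inE; apply: (iffP andP) => -[xD].
  by move=> /forallP h; split=> // y xy; move: (h y); rewrite xy.
by move=> h; split=> //; apply/forallP => y; apply/implyP/h.
Qed.

Lemma interior_sub D : interior D \subset D.
Proof. by apply/subsetP => x /interiorP[]. Qed.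

Lemma interiorS D D' : D \subset D' -> interior D \subset interior D'.
Proof.
move=> /subsetP sD; apply/subsetP => x /interiorP[xD h].
by apply/interiorP; split=> [|y /h]; apply: sD.
Qed.

(** The complements of the burning sets: after a step, a vertex is free of fire exactly when it and
    all its neighbours were extinguished or protected. *)
Definition extinguish C Fs : {set G} :=
  foldl (fun C F => interior (C :|: F)) C Fs.

Lemma extinguish_cat C Fs Fs' :
  extinguish C (Fs ++ Fs') = extinguish (extinguish C Fs) Fs'.
Proof. exact: foldl_cat. Qed.

Lemma extinguishS C C' Fs :
  C \subset C' -> extinguish C Fs \subset extinguish C' Fs.
Proof. by elim: Fs C C' => //= F Fs IH C C' sC; apply/IH/interiorS/setSU. Qed.

Lemma burning_rcons Fs F t :
  t <= size Fs -> burning (rcons Fs F) t = burning Fs t.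
Proof.
by elim: t => //= t IH lt_t; rewrite IH 1?ltnW // nth_rcons lt_t.
Qed.

Lemma spread_setC D : ~: D :|: nbhd (~: D) = ~: interior D.
Proof.
apply/setP => x; rewrite !inE negb_and; have [xD|] //= := boolP (x \in D).
rewrite negb_forall; apply: eq_existsb => y.
by rewrite negb_imply inE adj_sym andbC.
Qed.

Lemma burning_extinguish Fs : burning Fs (size Fs) = ~: extinguish set0 Fs.
Proof.
elim/last_ind: Fs => [|Fs F IH] /=; first by rewrite setC0.
rewrite size_rcons /= burning_rcons // IH nth_rcons ltnn eqxx.
by rewrite setDE -setCU spread_setC -cats1 extinguish_cat.
Qed.

Lemma winningE Fs : winning Fs <-> extinguish set0 Fs = [set: G].
Proof.
rewrite /winning burning_extinguish; split=> [h|->]; last exact: setCT.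
by rewrite -[LHS]setCK h setC0.
Qed.

Lemma card_interior_ff_wins m k : k <= #|G| ->
  (forall D, #|D| = k -> #|interior D| + m <= k) -> ~ ff_wins G m.
Proof.
move=> le_k hk [m_gt0 [Fs [sFs /winningE wFs]]].
(* [interior] is monotone, so a smaller set may be enlarged to exactly [k] vertices, which
   [k <= #|G|] permits. *)
have grow D : #|D| <= k -> #|interior D| + m <= k.
  move=> leD; suff [D' sDD' cD'] : exists2 D' : {set G}, D \subset D' & #|D'| = k.
    apply: leq_trans (hk _ cD'); rewrite leq_add2r.
    exact/subset_leq_card/interiorS.
  have: exists2 D' : {set G}, D \subset D' & #|D'| = #|D| + (k - #|D|).
    have: #|D| + (k - #|D|) <= #|G| by rewrite subnKC.
    elim: (k - #|D|) => [|n IH] le_n; first by exists D; rewrite ?addn0.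
    have [|D' sD' cD'] := IH; first by apply: leq_trans le_n; rewrite leq_add2l.
    have: 0 < #|~: D'| by have := cardsC D'; lia.
    case/card_gt0P => x; rewrite inE => xD'; exists (x |: D').
      exact: subset_trans sD' (subsetUr _ _).
    by rewrite cardsU1 xD' cD' addnS.
  by rewrite subnKC.
have inv Fs' C : (forall A, A \in Fs' -> #|A| <= m) -> #|C| + m <= k ->
    #|extinguish C Fs'| + m <= k.
  elim: Fs' C => //= F Fs' IH C hF hC; apply: IH.
    by move=> A AF; apply: hF; rewrite inE AF orbT.
  apply: grow; apply: leq_trans (leq_card_setU _ _) _.
  by apply: leq_trans hC; rewrite leq_add2l hF // mem_head.
have k_m : m <= k.
  have := grow set0; rewrite cards0 => /(_ isT); apply: leq_trans.
  exact: leq_addl.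
have := inv Fs set0 sFs; rewrite wFs cards0 cardsT => /(_ k_m); lia.
Qed.

Lemma ffn_le m : ff_wins G m -> ffn G <= m.
Proof.
by move=> wm; rewrite /ffn; case: ex_minnP => n _; apply; apply/asboolP.
Qed.

Lemma ff_wins_ffn : ff_wins G (ffn G).
Proof. by rewrite /ffn; case: ex_minnP => n /asboolP. Qed.

Lemma ff_winsS m n : m <= n -> ff_wins G m -> ff_wins G n.
Proof.
move=> le_mn [m_gt0 [Fs [sFs wFs]]]; split; first exact: leq_trans le_mn.
by exists Fs; split=> // A /sFs /leq_trans; apply.
Qed.

Lemma ltn_ffn m : ~ ff_wins G m -> m < ffn G.
Proof.
by move=> nw; rewrite ltnNge; apply/negP => /ff_winsS /(_ ff_wins_ffn).
Qed.

End Game.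

(** * Distances and rooted trees *)

Section Distance.
Variable G : sgraph.
Implicit Types (x y : G) (p : seq G).

Lemma dist_le_size x p : path (@adj G) x p -> dist x (last x p) <= size p.
Proof.
move=> xp; rewrite /dist; set a := (fun n : nat => _).
rewrite leqNgt; apply/negP => lt_p; have := before_find 0 lt_p.
(* [find] never exceeds the length of the list, so only paths with fewer than [#|G|] edges need to
   be looked up. *)
have lt_G : size p < #|G|.
  by apply: leq_trans lt_p _; rewrite -[X in _ <= X](size_iota 0) find_size.
rewrite nth_iota // add0n => /existsP[]; exists (in_tuple p).
by rewrite /= xp eqxx.
Qed.

Lemma dist_path x y : connect (@adj G) x y ->
  exists p, [/\ path (@adj G) x p, last x p = y & size p = dist x y].
Proof.
case/connectP=> p0 /shortenP[p xp up _] ->; rewrite {p0}.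
set y0 := last x p; rewrite /dist; set a := (fun n : nat => _).
have lt_G : size p < #|G|.
  by rewrite -[X in X <= _]/(size (x :: p)) -(card_uniqP up) max_card.
have hasa : has a (iota 0 #|G|).
  apply/hasP; exists (size p); first by rewrite mem_iota.
  by apply/existsP; exists (in_tuple p); rewrite /= xp eqxx.
have := nth_find 0 hasa; have := hasa; rewrite has_find size_iota => lt_f.
rewrite nth_iota // add0n => /existsP [q /andP[qp /eqP lq]].
by exists q; rewrite size_tuple.
Qed.

Lemma dist_le_card x y : dist x y <= #|G|.
Proof. by rewrite /dist -[X in _ <= X](size_iota 0) find_size. Qed.

End Distance.

Section RootedTree.
Variables (G : sgraph) (r : G).
Hypothesis tG : is_tree G.
Implicit Types x y u v : G.

Lemma dist_root : dist r r = 0.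
Proof. by apply/eqP; rewrite -leqn0; apply: (@dist_le_size G r [::]). Qed.

Lemma dist0_root x : dist r x = 0 -> x = r.
Proof.
by have [p [_ <- <-]] := dist_path (tG.1 r x); case: p.
Qed.

Lemma dist_adj x y : adj x y -> dist r y <= (dist r x).+1.
Proof.
move=> xy; have [p [rp lp <-]] := dist_path (tG.1 r x).
have := @dist_le_size G r (rcons p y).
by rewrite rcons_path rp lp xy last_rcons size_rcons; apply.
Qed.

Lemma exists_parent x k : dist r x = k.+1 -> exists2 y, adj x y & dist r y = k.
Proof.
move=> dx; have [p [rp lp sp]] := dist_path (tG.1 r x).
case/lastP: p rp lp sp => [|p z]; first by rewrite /= dx.
rewrite rcons_path last_rcons size_rcons dx => /andP[rp zx] zE [sp].
rewrite {}zE in zx.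
have zx' : adj x (last r p) by rewrite adj_sym.
exists (last r p) => //.
apply/eqP; rewrite eqn_leq; apply/andP; split; first by rewrite -sp dist_le_size.
by have := dist_adj zx; rewrite dx.
Qed.

(** Adjacency inside the ball of radius [k] about the root. A path in the ball misses every vertex
    farther away, so such a vertex can close it into a cycle. *)
Definition low_adj k : rel G :=
  fun x y => [&& adj x y, dist r x <= k & dist r y <= k].

Lemma low_connect k u v : dist r u <= k -> dist r v <= k ->
  connect (low_adj k) u v.
Proof.
have sym : connect_sym (low_adj k).
  by apply: sym_connect_sym => x y; rewrite /low_adj adj_sym [X in _ && X]andbC.
suff toroot x : dist r x <= k -> connect (low_adj k) x r.
  move=> uk vk; apply: (connect_trans (toroot _ uk)).
  by rewrite sym toroot.
elim: {x}(dist r x) {-2}x (erefl (dist r x)) => [|n IH] x dx le_k.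
  by rewrite (dist0_root dx) connect0.
have [y xy dy] := exists_parent dx.
apply: (connect_trans (y := y)).
  by apply: connect1; rewrite /low_adj xy le_k dy ltnW -?dx.
by apply: IH; rewrite // dy ltnW -?dx.
Qed.

Lemma low_path k u v : dist r u <= k -> dist r v <= k ->
  exists p, [/\ path (@adj G) u p, last u p = v, uniq (u :: p)
    & forall z, z \in u :: p -> dist r z <= k].
Proof.
move=> uk vk; have /connectP[p0 /shortenP[p up unp _] ->] := low_connect uk vk.
exists p; split=> //; first by apply: sub_path up => x y /and3P[].
move=> z; rewrite inE => /predU1P[->//|].
elim: p u up {unp uk} => [|y p IH] u //= /andP[/and3P[_ _ yk] yp].
by rewrite inE => /predU1P[->//|]; exact: IH yp.
Qed.

(** If [u] and [v] were distinct, a path between them in the ball of radius [k] together with [z]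
    would be a cycle on at least three vertices. *)
Lemma parent_unique z u v k : dist r z = k.+1 -> dist r u <= k -> dist r v <= k ->
  adj z u -> adj z v -> u = v.
Proof.
move=> dz uk vk zu zv; have [p [up lp unp pk]] := low_path uk vk.
case: p => [|y p] in up lp unp pk; first by rewrite -lp.
have := tG.2 (z :: u :: y :: p); rewrite /ucycle /= rcons_path.
move: up => /= /andP[-> ->]; rewrite (lp : last y p = v) zu adj_sym zv /=.
move: unp => /= ->; rewrite andbT.
suff -> : z \notin u :: y :: p by move/(_ isT).
by apply/negP => /pk; rewrite dz ltnn.
Qed.

(** Otherwise the edge, the parents of its two ends and a path joining these parents in the smaller
    ball form a cycle; it has at least three vertices even if the parents coincide. *)
Lemma adj_dist_neq x y : adj x y -> dist r x <> dist r y.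
Proof.
move=> xy dxy; case dx : (dist r x) => [|k].
  by move: xy; rewrite (dist0_root dx) (@dist0_root y) ?adj_irrefl // -dxy.
have [u xu du] := exists_parent dx.
have [|v yv dv] := @exists_parent y k; first by rewrite -dxy.
have [p [up lp unp pk]] := low_path (eq_leq du) (eq_leq dv).
have := tG.2 (y :: x :: u :: p); rewrite /ucycle /= rcons_path.
rewrite lp up xu adj_sym xy adj_sym yv /=; move: unp => /= ->.
suff [xp yp] : x \notin u :: p /\ y \notin u :: p.
  have yx : y != x.
    by apply: contraTneq xy => ->; rewrite adj_irrefl.
  by rewrite inE negb_or yx xp yp; move/(_ isT).
by split; apply/negP => /pk; rewrite -?dxy dx ltnn.
Qed.

End RootedTree.

(** * Labelling a complete binary tree by binary words *)

(* The word b :: w labels a child of the vertex labelled w. *)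
Record labelling (G : sgraph) (d : nat) (f : seq bool -> G) : Prop := Labelling {
  label_inj : forall u v, size u <= d -> size v <= d -> f u = f v -> u = v;
  label_surj : forall x, exists2 w, size w <= d & f w = x;
  label_child : forall b w, size w < d -> adj (f w) (f (b :: w));
  label_adj : forall w y, size w <= d -> adj (f w) y ->
    (w <> [::] /\ y = f (behead w)) \/ (size w < d /\ exists b, y = f (b :: w)) }.

Lemma complete_binary_tree_labelling (G : sgraph) (d : nat) :
  complete_binary_tree G d -> exists f, @labelling G d f.
Proof.
case=> tG [r [hleaf hnode]].
pose child (b : bool) (x : G) := nth x (enum (children r x)) b.
pose f := foldr child r.
have childE x b : ~~ is_leaf r x -> child b x \in children r x.
  by move=> /hnode c2; rewrite -mem_enum mem_nth // -cardE c2; case: b.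
have nonleaf x : dist r x <> d -> ~~ is_leaf r x.
  by move=> dx; apply/negP => /hleaf.
have fdist w : size w <= d -> dist r (f w) = size w.
  elim: w => [|b w IH] /= lt_w; first exact: dist_root.
  have dw := IH (ltnW lt_w).
  have /(childE _ b) : ~~ is_leaf r (f w) by apply: nonleaf; lia.
  by rewrite !inE dw => /andP[_ /eqP].
have fchild b w : size w < d -> adj (f w) (f (b :: w)).
  move=> lt_w; have dw := fdist w (ltnW lt_w).
  have /(childE _ b) : ~~ is_leaf r (f w) by apply: nonleaf; lia.
  by rewrite !inE => /andP[].
(* A vertex deeper than [d] is not a leaf, so it has a still deeper child; repeating this would
   exceed the bound [#|G|] on [dist]. *)
have dist_le x : dist r x <= d.
  rewrite leqNgt; apply/negP => lt_x.
  suff [y] : exists y, #|G| + d < dist r y.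
    by have := dist_le_card r y; lia.
  elim: #|G| => [|n [y dy]]; first by exists x.
  have yl : ~~ is_leaf r y by apply: nonleaf; lia.
  exists (child true y); have := childE _ true yl.
  by rewrite !inE => /andP[_ /eqP->]; lia.
have fchildren x y : y \in children r x ->
    ~~ is_leaf r x /\ exists b, y = child b x.
  move=> yx; have nl : ~~ is_leaf r x by apply/set0Pn; exists y.
  split=> //; exists (index y (enum (children r x)) == 1).
  rewrite /child; set i := index _ _.
  have : i < 2 by rewrite -(hnode _ nl) cardE index_mem mem_enum.
  have : nth x (enum (children r x)) i = y by rewrite nth_index ?mem_enum.
  by case: i => [|[|]].
exists f; split=> //.
- elim=> [|b u IH] [|c v] su sv //.
  + by move/(congr1 (dist r)); rewrite !fdist.
  + by move/(congr1 (dist r)); rewrite !fdist.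
  move=> fuv; have dz := fdist _ su.
  have uv : f u = f v.
    apply: (parent_unique (r := r) tG (z := f (b :: u)) (k := size u)) => //.
    - by rewrite fdist // ltnW.
    - by rewrite fdist ?(ltnW sv) //; move: dz; rewrite fuv fdist //= => -[->].
    - by rewrite adj_sym fchild.
    - by rewrite fuv adj_sym fchild.
  have euv : u = v by apply: IH; rewrite // ltnW.
  move: fuv; rewrite /= -uv -/f euv.
  have nl : ~~ is_leaf r (f v).
    by apply: nonleaf; rewrite (fdist _ (ltnW sv)); move: sv => /=; lia.
  rewrite /child => /eqP; rewrite nth_uniq ?enum_uniq -?cardE ?(hnode _ nl) //.
  - by case: b {su dz} => /=; case: c {sv} => //=.
  - by case: b {su dz}.
  - by case: c {sv}.
- move=> x; elim: {x}(dist r x) {-2}x (erefl (dist r x)) => [|k IH] x dx.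
    by exists [::] => //; rewrite (dist0_root tG dx).
  have [y xy dy] := exists_parent tG dx; have [w sw fw] := IH y dy.
  have /fchildren[nl [b xE]] : x \in children r y.
    by rewrite !inE adj_sym xy dx dy /=.
  exists (b :: w); last by rewrite /= -/f fw.
  by rewrite /= -(fdist w sw) fw dy -dx dist_le.
- move=> w y sw wy; have dw := fdist w sw.
  (* A nearer neighbour is the unique parent, a farther one is a child, and equal distances are
     impossible. *)
  have [lt_y|lt_w|eq_y] := ltngtP (dist r y) (dist r (f w)).
  + left; case: w sw wy dw lt_y => [|b w] sw wy dw lt_y.
      by move: lt_y; rewrite dw.
    split=> //=; apply: (parent_unique (r := r) tG dw) => //.
    - by move: lt_y; rewrite dw.
    - by rewrite fdist // ltnW.
    - by rewrite adj_sym fchild.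
  + right; have : y \in children r (f w).
      by rewrite !inE wy eqn_leq lt_w dist_adj.
    case/fchildren => _ [b ->]; split; last by exists b.
    by have := dist_le y; lia.
  + by case: (adj_dist_neq (r := r) tG wy).
Qed.

(** * Sums of at most [b] signed powers of 2 *)

Section SignedBinary.
Local Open Scope ring_scope.

Inductive signed_binary : nat -> int -> Prop :=
| SignedBinary0 b : signed_binary b 0
| SignedBinaryD b i x : signed_binary b x -> signed_binary b.+1 (x + (2 ^ i)%N%:Z)
| SignedBinaryB b i x : signed_binary b x -> signed_binary b.+1 (x - (2 ^ i)%N%:Z).

Lemma signed_binaryW a b x :
  (a <= b)%N -> signed_binary a x -> signed_binary b x.
Proof.
move=> le_ab ax; elim: ax b le_ab => {a x}
  [a b _|a i x _ IH [//|b] le_ab|a i x _ IH [//|b] le_ab].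
- exact: SignedBinary0.
- exact/SignedBinaryD/IH.
- exact/SignedBinaryB/IH.
Qed.

Lemma signed_binary_add a b x y :
  signed_binary a x -> signed_binary b y -> signed_binary (a + b) (x + y).
Proof.
move=> ax; elim: ax => {a x} [a|a i x _ IH|a i x _ IH] by_.
- by rewrite add0r; apply: signed_binaryW by_; rewrite leq_addl.
- by rewrite addrAC addSn; apply/SignedBinaryD/IH.
- by rewrite addrAC addSn; apply/SignedBinaryB/IH.
Qed.

(** Halve the terms other than 1 and -1. Equal units merge in pairs into one term of the half and
    opposite ones cancel, so at most one unit is left; an odd [x] thus uses up one of the [b]
    terms. *)
Lemma signed_binary_half b x : signed_binary b x ->
  exists y, (x = 2 * y /\ signed_binary b y) \/
    (exists2 c, b = c.+1 & (x = 2 * y + 1 \/ x = 2 * y - 1) /\ signed_binary c y).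
Proof.
elim=> {b x} [b|b i x _ IH|b i x _ IH].
- by exists 0; left; split=> //; apply: SignedBinary0.
- case: IH => y IH; case: i => [|i].
    case: IH => [[xE by_]|[c bE [[xE|xE] cy]]].
    + exists y; right; exists b => //; split=> //; left; lia.
    + exists (y + (2 ^ 0)%N%:Z); left; split; first by lia.
      by rewrite bE; apply: (@signed_binaryW c.+1) => //; apply: SignedBinaryD.
    + exists y; left; split; first by lia.
      by apply: signed_binaryW cy; rewrite bE; lia.
  exists (y + (2 ^ i)%N%:Z); rewrite expnS.
  case: IH => [[xE by_]|[c bE [xE cy]]].
    by left; split; [lia|apply: SignedBinaryD].
  right; exists c.+1; first by rewrite bE.
  by split; [lia|apply: SignedBinaryD].
- case: IH => y IH; case: i => [|i].
    case: IH => [[xE by_]|[c bE [[xE|xE] cy]]].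
    + exists y; right; exists b => //; split=> //; right; lia.
    + exists y; left; split; first by lia.
      by apply: signed_binaryW cy; rewrite bE; lia.
    + exists (y - (2 ^ 0)%N%:Z); left; split; first by lia.
      by rewrite bE; apply: (@signed_binaryW c.+1) => //; apply: SignedBinaryB.
  exists (y - (2 ^ i)%N%:Z); rewrite expnS.
  case: IH => [[xE by_]|[c bE [xE cy]]].
    by left; split; [lia|apply: SignedBinaryB].
  right; exists c.+1; first by rewrite bE.
  by split; [lia|apply: SignedBinaryB].
Qed.

(* Binary expansion 1 0 1 0 ... 1 0 1 with n ones. *)
Fixpoint alternating (n : nat) : nat :=
  if n is n'.+1 then (4 * alternating n' + 1)%N else 0%N.

Lemma alternating_lt n : (alternating n.+1 < 2 ^ n.*2.+1)%N.
Proof.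
elim: n => // n IH; rewrite doubleS 2!expnS.
by rewrite -[alternating n.+2]/(4 * alternating n.+1 + 1)%N; lia.
Qed.

(** Write a for [alternating n]. Halving 4a + 1 or 4a + 2 twice, with either rounding, gives a or a
    + 1 and meets an odd number at least once, so each pair of halvings costs a term. *)
Lemma signed_binary_alternating n b x : signed_binary b x ->
  x = alternating n \/ x = (alternating n).+1 -> (n <= b)%N.
Proof.
elim: n b x => // n IH b x bx /= xE.
have [y [[yE by_]|[c bE [yE cy]]]] := signed_binary_half bx.
  have [z [[zE bz]|[c' bE [zE cz]]]] := signed_binary_half by_.
    by exfalso; lia.
  by rewrite bE; apply: IH cz _; lia.
have [z [[zE cz]|[c' cE [zE cz]]]] := signed_binary_half cy.
  by rewrite bE; apply: IH cz _; lia.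
by rewrite bE cE; apply: leqW; apply: IH cz _; lia.
Qed.

(** For positive [l] the ends of the window are even, so rounding an odd [x] either way stays inside
    and halving reduces [l] by one. The width of the window later absorbs the error term of the
    count. *)
Lemma signed_binary_window l n b x : signed_binary b x ->
  (2 ^ l * alternating n)%N%:Z <= x <= (2 ^ l * (alternating n).+1)%N%:Z ->
  (n <= b)%N.
Proof.
elim: l b x => [|l IH] b x bx.
  by rewrite !expn0 !mul1n => xw; apply: signed_binary_alternating bx _; lia.
rewrite expnS => xw.
have [y [[yE by_]|[c bE [yE cy]]]] := signed_binary_half bx.
  by apply: IH by_ _; lia.
by rewrite bE; apply: leqW; apply: IH cy _; lia.
Qed.

End SignedBinary.

(** * Subtrees as lists of words *)

Fixpoint subtree (h : nat) (w : seq bool) : seq (seq bool) :=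
  if h is h'.+1 then w :: subtree h' (true :: w) ++ subtree h' (false :: w)
  else [:: w].

Lemma size_subtree h w : (size (subtree h w)).+1 = 2 ^ h.+1.
Proof.
elim: h w => // h IH w; rewrite expnS /= size_cat.
by have := IH (true :: w); have := IH (false :: w); lia.
Qed.

Lemma mem_subtree_self h w : w \in subtree h w.
Proof. by case: h => *; rewrite mem_head. Qed.

Lemma mem_subtree h w v :
  reflect (exists2 u, size u <= h & v = u ++ w) (v \in subtree h w).
Proof.
elim: h w => [|h IH] w /=.
  rewrite inE; apply: (iffP eqP) => [->|[[|//] _ ->//]]; by exists [::].
rewrite inE mem_cat; apply: (iffP idP).
  case/predU1P => [->|/orP[] /IH[u su ->]]; first by exists [::].
  - by exists (rcons u true); rewrite ?size_rcons ?cat_rcons.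
  - by exists (rcons u false); rewrite ?size_rcons ?cat_rcons.
case=> u; case/lastP: u => [_ ->|u b]; first by rewrite eqxx.
rewrite size_rcons ltnS cat_rcons => su vE; apply/orP; right; apply/orP.
by case: b vE => vE; [left|right]; apply/IH; exists u.
Qed.

Lemma uniq_subtree h w : uniq (subtree h w).
Proof.
elim: h w => //= h IH w; rewrite cat_uniq !IH mem_cat andbT /=.
apply/andP; split.
  apply/negP => /orP[] /mem_subtree[u _ /(congr1 size)];
  by rewrite size_cat /=; lia.
apply/hasPn => v /mem_subtree[u _ ->]; apply/negP => /mem_subtree[u' _] uE.
have /eqP := uE; rewrite eqseq_cat ?eqseq_cons ?andbF //.
by have := congr1 size uE; rewrite !size_cat /=; lia.
Qed.

(** * The size of a set in terms of its outer boundary *)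

Section WordBoundary.
Variables (d : nat) (P : pred (seq bool)).

(** The root is its own [behead], so there the parent disjunct contradicts [~~ P w]; below the
    leaves, [Pd] makes the child disjuncts false. *)
Definition word_boundary : pred (seq bool) := fun w =>
  ~~ P w && [|| P (behead w), P (true :: w) | P (false :: w)].

Hypothesis Pd : forall w, d < size w -> ~~ P w.
Local Open Scope ring_scope.

(* Cutting at the boundary vertices, a component of P whose top vertex has
   height j has 2^j.+1 - 1 vertices less those below it, so a boundary vertex
   of height j with parent bit p and c children in P contributes
   (c - 2p) 2^j + (p - c); c - 2p is 0, 1, -1, 2 or -2. *)
Lemma count_subtree_signed_binary h w : (size w + h = d)%N ->
  exists b x e, [/\ (count word_boundary (subtree h w) = word_boundary w + b)%N,
    signed_binary b x, - (2 * b%:Z) <= e <= b &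
    (count P (subtree h w))%:Z = x + e +
      (if P w then (2 ^ h.+1)%N%:Z - 1
       else (P (true :: w) + P (false :: w))%N%:Z * ((2 ^ h)%N%:Z - 1))].
Proof.
elim: h w => [|h IH] w wd.
  exists 0%N, 0, 0; split=> //; first exact: SignedBinary0.
  rewrite /= (negPf (@Pd (true :: w) _)) ?(negPf (@Pd (false :: w) _)) /=; try lia.
  by case: (P w).
(* Whether the top of a subtree is in the boundary depends on its parent too, so the induction
   leaves it out of [b]; it is charged here, where [P w] is known. *)
have child c : exists b x e, [/\
    (count word_boundary (subtree h (c :: w)) = b)%N,
    signed_binary b x, - (2 * b%:Z) <= e <= b &
    (count P (subtree h (c :: w)))%:Z = x + e +
      (if P w || P (c :: w) then (2 ^ h.+1)%N%:Z - 1 else 0)].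
  have [|b [x [e [bE bx eb ->]]]] := IH (c :: w); first by rewrite /=; lia.
  rewrite {}bE -[word_boundary _]/(~~ P (c :: w) && [|| P w, _ | _]) expnS.
  have [Pc|Pc] := boolP (P (c :: w)).
    by exists b, x, e; split=> //; case: (P w).
  have [Pw|Pw] := boolP (P w) => /=; last first.
    case Pt : (P [:: true, c & w]); case Pf : (P [:: false, c & w]) => /=.
    - exists b.+1, (x + (2 ^ h.+1)%N%:Z), (e - 2).
      by split; [lia|exact: SignedBinaryD|lia|rewrite expnS; lia].
    - exists b.+1, (x + (2 ^ h)%N%:Z), (e - 1).
      by split; [lia|exact: SignedBinaryD|lia|lia].
    - exists b.+1, (x + (2 ^ h)%N%:Z), (e - 1).
      by split; [lia|exact: SignedBinaryD|lia|lia].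
    - by exists b, x, e; split=> //; lia.
  case Pt : (P [:: true, c & w]); case Pf : (P [:: false, c & w]) => /=.
  - exists b.+1, x, (e - 1); split; [lia| |lia|lia].
    exact: signed_binaryW bx.
  - exists b.+1, (x - (2 ^ h)%N%:Z), e.
    by split; [lia|exact: SignedBinaryB|lia|lia].
  - exists b.+1, (x - (2 ^ h)%N%:Z), e.
    by split; [lia|exact: SignedBinaryB|lia|lia].
  - exists b.+1, (x - (2 ^ h.+1)%N%:Z), (e + 1).
    by split; [lia|exact: SignedBinaryB|lia|rewrite expnS; lia].
have [b1 [x1 [e1 [b1E bx1 eb1 c1]]]] := child true.
have [b2 [x2 [e2 [b2E bx2 eb2 c2]]]] := child false.
exists (b1 + b2)%N, (x1 + x2), (e1 + e2); split.
- by rewrite /= count_cat b1E b2E.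
- exact: signed_binary_add.
- by lia.
rewrite /= count_cat; move: c1 c2; rewrite !expnS.
case: (P w) => /=; first by lia.
by case: (P (true :: w)); case: (P (false :: w)) => /=; lia.
Qed.

Lemma count_signed_binary : exists x (c : bool) e,
  let b := count word_boundary (subtree d [::]) in
  [/\ signed_binary b x, - (2 * b%:Z) - 1 <= e <= b &
    (count P (subtree d [::]))%:Z = x + (c * 2 ^ d.+1)%N%:Z + e].
Proof.
have [b [x [e [bE bx eb ->]]]] := @count_subtree_signed_binary d [::] erefl.
rewrite {}bE -[word_boundary _]/(~~ P [::] && [|| P [::], _ | _]).
case P0 : (P [::]) => /=.
  by exists x, true, (e - 1); split; [|lia|rewrite mul1n; lia].
case Pt : (P [:: true]); case Pf : (P [:: false]) => /=.
- exists (x + (2 ^ d.+1)%N%:Z), false, (e - 2).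
  by split; [exact: SignedBinaryD|lia|rewrite expnS; lia].
- exists (x + (2 ^ d)%N%:Z), false, (e - 1).
  by split; [exact: SignedBinaryD|lia|lia].
- exists (x + (2 ^ d)%N%:Z), false, (e - 1).
  by split; [exact: SignedBinaryD|lia|lia].
- by exists x, false, e; split; [|lia|lia].
Qed.

End WordBoundary.

(** * From outer boundaries to lost games *)

Section LabelledTree.
Variables (G : sgraph) (d : nat) (f : seq bool -> G).
Hypothesis Lf : labelling d f.

Lemma perm_label : perm_eq (map f (subtree d [::])) (enum G).
Proof.
apply: uniq_perm; last 2 first.
- exact: enum_uniq.
- move=> x; rewrite mem_enum inE; have [w sw <-] := label_surj Lf x.
  by rewrite map_f //; apply/mem_subtree; exists w; rewrite ?cats0.
rewrite map_inj_in_uniq ?uniq_subtree // => u v.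
move=> /mem_subtree[u' su' ->] /mem_subtree[v' sv' ->]; rewrite !cats0.
exact: (label_inj Lf).
Qed.

Lemma card_label (S : {set G}) :
  #|S| = count (fun w => f w \in S) (subtree d [::]).
Proof.
rewrite cardE size_filter -(count_map f (mem S)) (permP perm_label).
by rewrite enumT.
Qed.

Lemma card_labelled_tree : #|G|.+1 = 2 ^ d.+1.
Proof.
by rewrite -(size_subtree d [::]) cardE -(perm_size perm_label) size_map.
Qed.

(* P is the complement of the set whose interior is bounded. *)
Lemma word_boundary_ff_wins m s : s < 2 ^ d.+1 ->
  (forall P : pred (seq bool), (forall w, d < size w -> ~~ P w) ->
     count P (subtree d [::]) = s ->
     m <= count (word_boundary P) (subtree d [::])) ->
  ~ ff_wins G m.
Proof.
rewrite -card_labelled_tree => lt_s hs.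
apply: (@card_interior_ff_wins G m (#|G| - s)); first by rewrite leq_subr.
move=> D cD; pose P w := (size w <= d) && (f w \notin D).
have le_d w : w \in subtree d [::] -> size w <= d.
  by case/mem_subtree=> u su ->; rewrite cats0.
have cP : count P (subtree d [::]) = s.
  transitivity #|~: D|; last by have := cardsC D; lia.
  rewrite card_label; apply: eq_in_count => w /le_d.
  by rewrite /P inE => ->.
have Pd w : d < size w -> ~~ P w by rewrite /P ltnNge => /negPf->.
have sub : count (word_boundary P) (subtree d [::]) <= #|D :\: interior D|.
  rewrite card_label; set a := word_boundary P; set a' := fun w => _.
  (* [sub_count] compares predicates on all words, so membership in the tree is first put into the
     predicate. *)
  rewrite (@eq_in_count _ a (predI a (mem (subtree d [::])))); last first.
    by move=> w /= ->; rewrite andbT.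
  apply: sub_count => w /andP[/andP[+ nb] /= ws].
  rewrite /a' /P inE (le_d _ ws) /= negbK => wD; rewrite wD andbT.
  have not_int y : adj (f w) y -> y \notin D -> f w \notin interior D.
    by move=> wy yD; apply/negP => /interiorP[_ /(_ _ wy)]; rewrite (negPf yD).
  case/or3P: nb => /andP[sb]; last 2 first.
  - by apply/not_int/(label_child Lf).
  - by apply/not_int/(label_child Lf).
  case: w ws wD not_int sb => [|b w] ws wD not_int sb /=; first by rewrite wD.
  by apply/not_int; rewrite adj_sym; apply: (label_child Lf); apply: le_d ws.
have := leq_trans (hs P Pd cP) sub.
by rewrite cardsDS ?interior_sub // cD; have := subset_leq_card (interior_sub D); lia.
Qed.

End LabelledTree.

(** * Sweeping strategies and the upper bound *)

Section Sweeping.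
Variable G : sgraph.
Implicit Types (C F Z : {set G}) (v : G).

(** [Z] separates [C] from the remaining vertices, so protecting [Z] keeps [C] extinguished. *)
Definition guarded C Z : Prop :=
  forall x y, x \in C -> adj x y -> y \in C :|: Z.

Definition sweeps m C C' : Prop :=
  exists Fs, is_strategy m Fs /\ C' \subset extinguish C Fs.

Lemma guardedS C Z Z' : Z \subset Z' -> guarded C Z -> guarded C Z'.
Proof. by move=> sZ gC x y xC xy; apply: (subsetP (setUS C sZ)); apply: gC xy. Qed.

Lemma guarded_add v C Z : (forall y, adj v y -> y \in C :|: Z) ->
  guarded C (v |: Z) -> guarded (v |: C) Z.
Proof.
move=> vC gC x y; rewrite -setUA in_setU1 => /predU1P[-> /vC yC|xC xy].
  by rewrite in_setU1 yC orbT.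
by have := gC x y xC xy; rewrite setUCA.
Qed.

Lemma sweepsS m C C1 C2 : C2 \subset C1 -> sweeps m C C1 -> sweeps m C C2.
Proof. by move=> sC [Fs [sF hF]]; exists Fs; split=> //; apply: subset_trans hF. Qed.

Lemma sweeps_trans m C1 C2 C3 : sweeps m C1 C2 -> sweeps m C2 C3 -> sweeps m C1 C3.
Proof.
move=> [Fs [sF hF]] [Fs' [sF' hF']]; exists (Fs ++ Fs'); split.
  by move=> A; rewrite mem_cat => /orP[/sF|/sF'].
by rewrite extinguish_cat; apply: subset_trans hF' (extinguishS _ hF).
Qed.

(** One step protecting [v |: Z] suffices: every neighbour of [v] or of [C] is then extinguished or
    protected. *)
Lemma sweeps_add m v C Z : #|Z| < m -> (forall y, adj v y -> y \in C :|: Z) ->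
  guarded C (v |: Z) -> sweeps m C (v |: C).
Proof.
move=> Zm vC gC; exists [:: v |: Z]; split.
  move=> A; rewrite inE => /eqP->; apply: leq_trans Zm.
  by rewrite cardsU1 -add1n leq_add2r leq_b1.
apply/subsetP => x; rewrite /= in_setU1 => /predU1P[->|xC]; apply/interiorP.
  split; first by rewrite !inE eqxx orbT.
  by move=> y /vC; rewrite setUCA => yC; rewrite in_setU1 yC orbT.
by split; [rewrite in_setU xC|move=> y; apply: gC].
Qed.

End Sweeping.

Section UpperBound.
Variables (G : sgraph) (d : nat) (f : seq bool -> G).
Hypothesis Lf : labelling d f.

Definition subtree_set h w : {set G} := [set x in map f (subtree h w)].

Lemma subtree_setS h w : subtree_set h.+1 w =
  f w |: (subtree_set h (true :: w) :|: subtree_set h (false :: w)).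
Proof.
apply/setP => x.
by rewrite in_setU1 in_setU !in_set -mem_cat -map_cat -in_cons.
Qed.

Lemma subtree_set0 w : subtree_set 0 w = [set f w].
Proof. by apply/setP => x; rewrite !inE. Qed.

Lemma subtree_set_self h w : f w \in subtree_set h w.
Proof. by rewrite inE map_f ?mem_subtree_self. Qed.

Lemma guarded_subtree h w (C Z : {set G}) : size w + h = d ->
  (w <> [::] -> f (behead w) \in Z) ->
  guarded C Z -> guarded (C :|: subtree_set h w) Z.
Proof.
move=> wd wZ gC x y; rewrite !in_setU => /orP[xC xy|].
  by have := gC x y xC xy; rewrite in_setU => /orP[]->; rewrite ?orbT.
rewrite -orbA => /[swap] xy /[!inE] /mapP[v /mem_subtree[u su ->] xE].
rewrite {}xE in xy; apply/orP; right.
have suw : size (u ++ w) <= d by rewrite size_cat; lia.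
have [[uw ->]|[lt_d [b ->]]] := label_adj Lf suw xy.
  case: u su suw xy uw => [|c u] /= su _ _; first by move=> /wZ ->; rewrite orbT.
  by move=> _; rewrite map_f //; apply/mem_subtree; exists u; rewrite // ltnW.
rewrite map_f //; apply/mem_subtree; exists (b :: u) => //=.
by move: lt_d; rewrite size_cat; lia.
Qed.

(** The induction descends two levels at a time, and two levels cost a single extra guard, matching
    the growth of [uphalf h]. *)
Lemma sweeps_subtree h w (C Z : {set G}) m : size w + h = d ->
  #|Z| + uphalf h < m -> (w <> [::] -> f (behead w) \in Z) ->
  guarded C Z -> sweeps m C (C :|: subtree_set h w).
Proof.
have in_sub := (subtree_set_self, eqxx, orbT).
have card_add (v : G) (A : {set G}) : #|v |: A| <= #|A|.+1.
  by rewrite cardsU1 -add1n leq_add2r leq_b1.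
have [n] := ubnP h; elim: n h w C Z => // n IH [|[|h]] w C Z lt_h wd Zm wZ gC.
- rewrite subtree_set0 setUC; apply: (@sweeps_add _ _ _ _ Z).
  + by move: Zm; rewrite addn0.
  + move=> y /(label_adj Lf)[|[/wZ yZ ->]|[]]; [lia| |lia].
    by rewrite in_setU yZ orbT.
  + exact: guardedS (subsetUr _ _) gC.
(* At height 1 the order is one child, the top, the other child. *)
- set a := f (true :: w); set b := f (false :: w).
  have Za := card_add (f w) Z; have Zb := card_add b Z.
  have nbr c y : adj (f (c :: w)) y -> y = f w.
    case/(label_adj Lf) => [|[_ -> //]|[]]; rewrite /=; lia.
  have g1 : guarded (a |: C) (f w |: Z).
    apply: guarded_add; last by apply: guardedS gC; rewrite setUA subsetUr.
    by move=> y /nbr ->; rewrite !in_setU in_set1 !in_sub.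
  have nw y : adj (f w) y -> y \in (a |: C) :|: (b |: Z).
    case/(label_adj Lf) => [|[/wZ yZ ->]|[_ [[] ->]]]; first by lia.
    - by rewrite !in_setU yZ !in_sub.
    - by rewrite !in_setU !in_set1 !in_sub.
    - by rewrite !in_setU !in_set1 !in_sub.
  have g1' : guarded (a |: C) (f w |: (b |: Z)).
    by apply: guardedS g1; rewrite setUS ?subsetUr.
  have g2 := guarded_add nw g1'.
  apply: (sweeps_trans (C2 := a |: C)).
    apply: (sweeps_add (Z := f w |: Z)); first by move: Zm => /=; lia.
      by move=> y /nbr ->; rewrite !in_setU in_set1 !in_sub.
    by apply: guardedS gC; rewrite setUA subsetUr.
  apply: (sweeps_trans (C2 := f w |: (a |: C))).
    by apply: (sweeps_add (Z := b |: Z)) => //; move: Zm => /=; lia.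
  apply: (sweepsS (C1 := b |: (f w |: (a |: C)))).
    rewrite subtree_setS !subtree_set0; apply/subsetP => x.
    rewrite !in_setU !in_set1.
    by case/or3P=> [->|->|/orP[]->]; rewrite ?orbT.
  apply: (sweeps_add (Z := Z)) => //; first by move: Zm => /=; lia.
  by move=> y /nbr ->; rewrite !in_setU in_set1 !in_sub.
(* Order: the two subtrees below [a], guarded by [a]; then [a], guarded by [f w]; then [f w],
   guarded by [b]; then the two subtrees below [b], guarded by [b]; finally [b]. At each stage at
   most one guard is added to [Z]. *)
set a := f (true :: w); set b := f (false :: w).
have Za := card_add a Z; have Zw := card_add (f w) Z; have Zb := card_add b Z.
have mZ : (#|Z|.+1 + uphalf h < m) by move: Zm => /=; lia.
have sub c c' (C' Z' : {set G}) : f (c' :: w) \in Z' ->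
    #|Z'| <= #|Z|.+1 -> guarded C' Z' ->
    sweeps m C' (C' :|: subtree_set h (c :: c' :: w)) /\
    guarded (C' :|: subtree_set h (c :: c' :: w)) Z'.
  move=> cZ cardZ gC'; split; last by apply: guarded_subtree; rewrite //=; lia.
  by apply: (IH h _ _ Z') => //=; [lia|lia|apply: leq_ltn_trans mZ; rewrite leq_add2r].
have nbr c y : adj (f (c :: w)) y -> [\/ y = f w, y = f (true :: c :: w)
    | y = f (false :: c :: w)].
  case/(label_adj Lf) => [|[_ -> //]|[_ [[] ->]]]; first by rewrite /=; lia.
  - by constructor 1.
  - by constructor 2.
  - by constructor 3.
have [s1 g1] := sub true true C _ (setU11 _ _) Za (guardedS (subsetUr _ _) gC).
have [s2 g2] := sub false true _ _ (setU11 _ _) Za g1.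
set C2 := (X in sweeps _ _ X) in s2.
have na y : adj a y -> y \in C2 :|: (f w |: Z).
  by case/nbr => ->; rewrite !in_setU ?in_set1 !in_sub.
have ga : guarded C2 (a |: (f w |: Z)).
  by apply: guardedS g2; rewrite setUS ?subsetUr.
have g3 := guarded_add na ga.
have s3 : sweeps m C2 (a |: C2).
  by apply: (sweeps_add (Z := f w |: Z)) => //; move: mZ Zw; lia.
have nw y : adj (f w) y -> y \in (a |: C2) :|: (b |: Z).
  case/(label_adj Lf) => [|[/wZ yZ ->]|[_ [[] ->]]]; first by lia.
  - by rewrite !in_setU yZ !in_sub.
  - by rewrite !in_setU !in_set1 !in_sub.
  - by rewrite !in_setU !in_set1 !in_sub.
have gw : guarded (a |: C2) (f w |: (b |: Z)).
  by apply: guardedS g3; rewrite setUS ?subsetUr.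
have g4 := guarded_add nw gw.
have s4 : sweeps m (a |: C2) (f w |: (a |: C2)).
  by apply: (sweeps_add (Z := b |: Z)) => //; move: mZ Zb; lia.
have [s5 g5] := sub true false _ _ (setU11 _ _) Zb g4.
have [s6 g6] := sub false false _ _ (setU11 _ _) Zb g5.
set C6 := (X in sweeps _ _ X) in s6.
have s7 : sweeps m C6 (b |: C6).
  apply: (sweeps_add (Z := Z)) => //; first by lia.
  by move=> y /nbr[] ->; rewrite !in_setU ?in_set1 !in_sub.
apply: (sweeps_trans s1); apply: (sweeps_trans s2); apply: (sweeps_trans s3).
apply: (sweeps_trans s4); apply: (sweeps_trans s5); apply: (sweeps_trans s6).
apply: sweepsS s7; rewrite !subtree_setS; apply/subsetP => x.
rewrite /C6 /C2 !in_setU !in_set1 -!orbA.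
by repeat (case/orP=> [->|]; rewrite ?orbT //); move=> ->; rewrite ?orbT.
Qed.

Lemma ffn_upper_bound : ffn G <= uphalf d + 1.
Proof.
apply: ffn_le; split; first by rewrite addn1.
have [|||Fs [sF wF]] := @sweeps_subtree d [::] set0 set0 (uphalf d + 1) erefl.
- by rewrite cards0 addn1.
- by [].
- by move=> x y; rewrite inE.
exists Fs; split=> //; apply/winningE/eqP; rewrite eqEsubset subsetT /=.
apply: subset_trans wF; apply/subsetP => x _; rewrite in_setU; apply/orP; right.
have [w sw <-] := label_surj Lf x; rewrite inE map_f //.
by apply/mem_subtree; exists w; rewrite ?cats0.
Qed.

End UpperBound.

(** * Lower bounds from signed binary expansions *)

Lemma ff_wins_lower_bound (G : sgraph) (d : nat) (f : seq bool -> G) (m q : nat) :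
  labelling d f -> 2 * q < d -> 2 < q -> m + 2 <= q ->
  q - 2 <= 4 ^ (q - m - 2) -> ~ ff_wins G m.
Proof.
move=> Lf dq q3 mq jq; pose l := d - 1 - 2 * m.
have [->|m_gt0] := posnP m; first by case.
have l_ge : 16 * (q - 2) <= 2 ^ l.
  apply: (@leq_trans (2 ^ (2 * (q - m - 2) + 4))).
    by rewrite addnC expnD expnM leq_mul2l.
  by rewrite leq_exp2l // /l; lia.
have alt : 2 ^ l * (alternating m.+1).+1 <= 2 ^ d.
  have -> : d = l + m.*2.+1 by rewrite /l; lia.
  by rewrite expnD leq_mul2l alternating_lt orbT.
(* With fewer than [m] boundary vertices the error lies between -2m + 1 and m - 1. The offset [m.-1]
   keeps the size minus the error above the lower end of the window, and 3m - 2 <= [2 ^ l] keeps it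
   below the upper end. *)
apply: (@word_boundary_ff_wins _ _ _ Lf m (2 ^ l * alternating m.+1 + m.-1)).
  by move: alt; rewrite expnS mulnS; lia.
move=> P Pd cP; set b := count _ _.
have [x [c [e]]] := count_signed_binary Pd.
rewrite -/b cP => -[bx eb sE]; rewrite leqNgt; apply/negP => lt_bm.
(* The whole-tree term counts as one more power of 2, whence [m.+1] ones in the pattern. *)
have: signed_binary b.+1 (x + (c * 2 ^ d.+1)%N%:Z).
  case: c {sE}; rewrite ?mul1n; first exact: SignedBinaryD.
  by rewrite mul0n addr0; apply: signed_binaryW bx.
move/(@signed_binary_window l m.+1) => win; suff: m < b.+1 by lia.
by apply: win; rewrite mulnS; lia.
Qed.

Lemma ff_wins2_lower_bound (G : sgraph) (d : nat) (f : seq bool -> G) :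
  labelling d f -> 4 <= d <= 6 -> ~ ff_wins G 2.
Proof.
move=> Lf d46; apply: (@word_boundary_ff_wins _ _ _ Lf 2 12).
  (* Why 12: with at most one boundary vertex the error is in [-3, 1], so [x] would lie in [11, 15]
     shifted down by 0, 32, 64 or 128. None of these ranges contains 0 or a signed power of 2. *)
  by case: d d46 {Lf} => [|[|[|[|[|[|[|d]]]]]]].
move=> P Pd cP; set b := count _ _.
have [x [c [e]]] := count_signed_binary Pd.
rewrite -/b cP => -[bx eb sE]; rewrite leqNgt; apply/negP => lt_b2.
have {}eb : (-3 <= e <= 1)%R by lia.
have {}bx : signed_binary 1 x by apply: signed_binaryW bx.
have [i xE] : exists i, [\/ x = 0, x = (2 ^ i)%N | x = - (2 ^ i)%N%:Z]%R.
  inversion bx as [|? i y sy|? i y sy]; first by exists 0; constructor 1.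
    by exists i; inversion sy; rewrite add0r; constructor 2.
  by exists i; inversion sy; rewrite sub0r; constructor 3.
have pow : (2 ^ i \in [:: 1; 2; 4; 8; 16; 32; 64]) || (128 <= 2 ^ i).
  have [le_i|] := leqP 7 i; first by rewrite (@leq_exp2l 2 7) // le_i orbT.
  by case: i {xE} => [|[|[|[|[|[|[|i]]]]]]].
have cases : c * 2 ^ d.+1 \in [:: 0; 32; 64; 128].
  by case: c {sE} => //; case: d d46 {Lf Pd cP b bx lt_b2} => [|[|[|[|[|[|[|d]]]]]]].
move: (c * 2 ^ d.+1) cases sE => t; rewrite !inE => cases sE.
by move: (2 ^ i) pow xE => z; rewrite !inE => pow [] xE; lia.
Qed.

(** * Exhaustive check for small depths *)

Fixpoint forall_bits (n : nat) (p : seq bool -> bool) : bool :=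
  if n is n'.+1 then
    forall_bits n' (fun s => p (true :: s)) && forall_bits n' (fun s => p (false :: s))
  else p [::].

Lemma forall_bitsP n p : forall_bits n p -> forall s, size s = n -> p s.
Proof.
elim: n p => [|n IH] p /=; first by move=> p0 [].
move=> /andP[pt pf] [|[] s] //= [sn]; [exact: (IH _ pt)|exact: (IH _ pf)].
Qed.

(** Bit strings encode the sets of words. The [if] spares call-by-value evaluation the boundary
    count for sets of the wrong size. *)
Definition small_boundary_check (d m s : nat) : bool :=
  let ws := subtree d [::] in
  forall_bits (size ws) (fun bits =>
    if count id bits == s then
      m <= count (word_boundary (fun w => nth false bits (index w ws))) ws
    else true).

Lemma small_boundary_ff_wins (G : sgraph) (d : nat) (f : seq bool -> G) (m s : nat) :
  labelling d f -> s < 2 ^ d.+1 -> small_boundary_check d m s -> ~ ff_wins G m.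
Proof.
move=> Lf lt_s chk; apply: (word_boundary_ff_wins Lf lt_s) => P Pd cP.
have := forall_bitsP chk (s := map P (subtree d [::])); rewrite size_map.
move=> /(_ erefl); rewrite count_map (eq_count (a2 := P)) // cP eqxx.
set P' := fun w => nth _ _ _.
have PE w : P' w = P w.
  rewrite /P'; have [wd|wd] := boolP (w \in subtree d [::]).
    by rewrite (nth_map [::]) ?index_mem // nth_index.
  (* A word outside the tree gets the default [false], in agreement with [Pd]. *)
  rewrite nth_default ?size_map; last by rewrite leqNgt index_mem.
  apply/esym/negbTE/Pd; rewrite ltnNge; apply: contra wd => wd.
  by apply/mem_subtree; exists w; rewrite ?cats0.
by rewrite (eq_count (a2 := word_boundary P)) // => w; rewrite /word_boundary !PE.
Qed.

(** * The logarithmic bound and the final assembly *)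

Lemma log2_le_nat (R : realType) (m n q : nat) : 0 < n ->
  (m%:R <= q%:R - 1 / 2 * log2 (n%:R : R) - 2)%R ->
  m + 2 <= q /\ n <= 4 ^ (q - m - 2).
Proof.
move=> n_gt0; rewrite /log2 => hm.
have ln2_gt0 : (0 < ln 2 :> R)%R by rewrite ln_gt0 ?ltr1n.
have ln_n : (0 <= ln (n%:R : R))%R by rewrite ln_ge0 // ler1n.
have log_ge0 : (0 <= ln (n%:R : R) / ln 2)%R by rewrite divr_ge0 // ltW.
(* The logarithm is nonnegative, so the subtraction [q - m - 2] below is not truncated. *)
have mq : m + 2 <= q by rewrite -(ler_nat R) natrD; lra.
split=> //; rewrite -(ler_nat R) (_ : 4 = 2 ^ 2) // -expnM natrX.
have pos : (0 < 2%:R ^+ (2 * (q - m - 2)) :> R)%R by rewrite exprn_gt0.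
rewrite -ler_ln ?posrE ?ltr0n // lnXn // -[leRHS]mulr_natl.
by rewrite -ler_pdivrMr // natrM -subnDA natrB // natrD; lra.
Qed.

Theorem theorem1 (R : realType) (B : nat -> sgraph)
    (hB : forall d : nat, complete_binary_tree (B d) d) :
  ffn (B 0) = 1 /\
  (ffn (B 1) = 2 /\ ffn (B 2) = 2) /\
  (ffn (B 3) = 3 /\ ffn (B 4) = 3) /\
  (ffn (B 5) \in [:: 3; 4] /\ ffn (B 6) \in [:: 3; 4]) /\
  (forall d : nat, 7 <= d ->
     (((d - 1) %/ 2)%:R - 1 / 2 * log2 (((d - 5) %/ 2)%:R : R) - 2
        < (ffn (B d))%:R)%R /\
     ffn (B d) <= uphalf d + 1).
Proof.
have up d : ffn (B d) <= uphalf d + 1.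
  by have [f Lf] := complete_binary_tree_labelling (hB d); apply: ffn_upper_bound Lf.
have small d m s : s < 2 ^ d.+1 -> small_boundary_check d m s -> m < ffn (B d).
  have [f Lf] := complete_binary_tree_labelling (hB d) => lt_s chk.
  exact/ltn_ffn/(small_boundary_ff_wins Lf lt_s chk).
have mid d : 4 <= d <= 6 -> 2 < ffn (B d).
  have [f Lf] := complete_binary_tree_labelling (hB d) => d46.
  exact/ltn_ffn/(ff_wins2_lower_bound Lf).
have [u0 u1 u2 u3] := And4 (up 0) (up 1) (up 2) (up 3).
have [u4 u5 u6] := And3 (up 4) (up 5) (up 6).
have l0 : 0 < ffn (B 0) by case: (ff_wins_ffn (B 0)).
(* The sizes checked: in depths 1 and 2 every single vertex has an outer boundary vertex, and in
   depth 3 every set of four vertices has at least two. *)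
have l1 : 1 < ffn (B 1) by apply: (small 1 1 1); last by vm_compute.
have l2 : 1 < ffn (B 2) by apply: (small 2 1 1); last by vm_compute.
have l3 : 2 < ffn (B 3) by apply: (small 3 2 4); last by vm_compute.
have [l4 l5 l6] := And3 (mid 4 isT) (mid 5 isT) (mid 6 isT).
rewrite !inE; move: u0 u1 u2 u3 u4 u5 u6 => /=.
do 4!(split; first by lia); move=> d d7; split; last exact: up.
rewrite ltNge; apply/negP => le_ffn.
(* Here q is [(d - 1) %/ 2], and [(d - 5) %/ 2] equals q - 2, which is positive because [7 <= d]. *)
have [|q_m q_pow] := log2_le_nat _ le_ffn; first by lia.
have [f Lf] := complete_binary_tree_labelling (hB d).
apply: (@ff_wins_lower_bound _ _ _ (ffn (B d)) ((d - 1) %/ 2) Lf).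
- by lia.
- by lia.
- by lia.
- by apply: leq_trans q_pow; lia.
- exact: ff_wins_ffn.
Qed.
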